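(* Let $G,F$ be division rings and let $n>1$ be an integer. The following conditions are equivalent: (1) There exists a ring extension $G\subseteq F$ (i.e. a ring embedding of $G$ into $F$) such that the right dimension sequence of the resulting $(G,F)$-bimodule $F$ is $(1,\underbrace{2,\dots,2}_{(n-1)\times},1,n)$, of length $n+2$ (that is, it is periodic and this is a period of length $n+2$). (2) There exists a tight embedding of $F$ into $M_n(G)$.
   Context: Rings are associative and unital; ring embeddings are injective unital ring homomorphisms. For division rings $G,F$ and a $(G,F)$-bimodule $M$, the right dual of $M$ is the $(F,G)$-bimodule $M^r=\operatorname{Hom}_F(M_F,F_F)$ with $(f\varphi g)(m)=f\varphi(gm)$; then $M^{rr}=\operatorname{Hom}_G((M^r)_G,G_G)$ is a $(G,F)$-bimodule, and so on. The right dimension sequence of $M$ is $(\dim M_F,\dim (M^r)_G,\dim (M^{rr})_F,\dots)$. If it is periodic, one often writes only a finite period. Tightness: let $\varphi:F\to M_n(G)$ be a ring embedding with $F,G$ division rings. For positive integers $a,b$ with $a+b=n+1$, $\varphi$ is called $a$-tight if for every $a\times b$ matrix $g$ with entries from $G$ there exists $f\in F$ such that the upper right $a\times b$ corner block of $\varphi(f)$ is $g$. The embedding $\varphi$ is called tight if it is $a$-tight for each $a\in\{1,2,\dots,n\}$. *)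

(* Defs.v *)
From HB Require Import structures.
From mathcomp Require Import all_boot all_order all_algebra.
From mathcomp Require Import boolp.

Set Implicit Arguments.
Unset Strict Implicit.
Unset Printing Implicit Defensive.

Import GRing.Theory.
Local Open Scope ring_scope.

(* Right modules over F are left modules over the converse ring F^c: the right
   action m . x is (x : F^c) *: m. *)
Definition ract (F : pzRingType) (M : lmodType F^c) (m : M) (x : F) : M :=
  (x : F^c) *: m.

Record bimodule (G F : pzRingType) := Bimodule {
  bimod_sort :> lmodType F^c;
  lact : G -> bimod_sort -> bimod_sort;
  lact1 : forall m, lact 1 m = m;
  lactM : forall g h m, lact (g * h) m = lact g (lact h m);
  lactDl : forall g h m, lact (g + h) m = lact g m + lact h m;
  lactDr : forall g m m', lact g (m + m') = lact g m + lact g m';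
  lact_ract : forall g m x, lact g (ract m x) = ract (lact g m) x
}.

Section RightDual.
Context (G F : pzRingType) (M : bimodule G F).

(* F^c^o is F as a right module over itself: a *: y is y * a computed in F. *)
Definition rdual_sort : Type := {linear M -> F^c^o}.

Implicit Types (phi psi : rdual_sort) (x : F) (g : G) (m : M).

Definition rdual_val phi m : F := (phi : {linear M -> F^c^o}) m.

Lemma rdual_val_inj phi psi : rdual_val phi =1 rdual_val psi -> phi = psi.
Proof.
case: phi => f [[a] [b]]; case: psi => f' [[a'] [b']] /= e.
have {}e : f = f' by apply/funext.
subst f'; congr (GRing.Linear.Pack (GRing.Linear.Class _ _));
  by congr (_ _); exact: Prop_irrelevance.
Qed.

HB.instance Definition _ := gen_eqMixin rdual_sort.
HB.instance Definition _ := gen_choiceMixin rdual_sort.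

Definition rdual_zero : rdual_sort := \0 : {linear M -> F^c^o}.
Definition rdual_opp phi : rdual_sort :=
  \- (phi : {linear M -> F^c^o}) : {linear M -> F^c^o}.
Definition rdual_add phi psi : rdual_sort :=
  ((phi : {linear M -> F^c^o}) \+ (psi : {linear M -> F^c^o}))
    : {linear M -> F^c^o}.

Lemma rdual_addA : associative rdual_add.
Proof. by move=> p q r; apply: rdual_val_inj => m; exact: addrA. Qed.
Lemma rdual_addC : commutative rdual_add.
Proof. by move=> p q; apply: rdual_val_inj => m; exact: addrC. Qed.
Lemma rdual_add0 : left_id rdual_zero rdual_add.
Proof. by move=> p; apply: rdual_val_inj => m; exact: add0r. Qed.
Lemma rdual_addN : left_inverse rdual_zero rdual_opp rdual_add.
Proof. by move=> p; apply: rdual_val_inj => m; exact: addNr. Qed.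

HB.instance Definition _ := GRing.isZmodule.Build rdual_sort
  rdual_addA rdual_addC rdual_add0 rdual_addN.

(* (phi g)(m) = phi (g m) *)
Fact rdual_scale_linear g phi :
  linear ((fun m => rdual_val phi (lact g m)) : M -> F^c^o).
Proof.
by move=> a u v; rewrite lactDr (lact_ract g u a) /rdual_val linearP.
Qed.
Definition rdual_scale g phi : rdual_sort :=
  HB.pack_for {linear M -> F^c^o}
    ((fun m => rdual_val phi (lact g m)) : M -> F^c^o)
    (GRing.isLinear.Build _ _ _ _ _ (rdual_scale_linear g phi)).

Lemma rdual_scaleA (g h : G^c) phi :
  rdual_scale g (rdual_scale h phi) = rdual_scale (g * h) phi.
Proof.
apply: rdual_val_inj => m.
exact: (congr1 (rdual_val phi) (esym (lactM (h : G) g m))).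
Qed.
Lemma rdual_scale1 : left_id (1 : G^c) rdual_scale.
Proof. by move=> p; apply: rdual_val_inj => m; rewrite /rdual_val /= lact1. Qed.
Lemma rdual_scaleDr : right_distributive (rdual_scale : G^c -> _) +%R.
Proof. by move=> g p q; apply: rdual_val_inj. Qed.
Lemma rdual_scaleDl phi :
  {morph (rdual_scale : G^c -> _)^~ phi : a b / a + b}.
Proof.
move=> g h; apply: rdual_val_inj => m.
by rewrite [LHS](congr1 (rdual_val phi) (lactDl (g : G) h m)) /rdual_val raddfD.
Qed.

HB.instance Definition _ := GRing.Zmodule_isLmodule.Build G^c rdual_sort
  rdual_scaleA rdual_scale1 rdual_scaleDr rdual_scaleDl.

(* (x phi)(m) = x (phi m) *)
Fact rdual_lact_linear x phi :
  linear ((fun m => x * rdual_val phi m) : M -> F^c^o).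
Proof. by move=> a u v; rewrite /rdual_val linearP mulrDr mulrA. Qed.
Definition rdual_lact x phi : rdual_sort :=
  HB.pack_for {linear M -> F^c^o}
    ((fun m => x * rdual_val phi m) : M -> F^c^o)
    (GRing.isLinear.Build _ _ _ _ _ (rdual_lact_linear x phi)).

Lemma rdual_lact1 phi : rdual_lact 1 phi = phi.
Proof. by apply: rdual_val_inj => m; exact: mul1r. Qed.
Lemma rdual_lactM x y phi :
  rdual_lact (x * y) phi = rdual_lact x (rdual_lact y phi).
Proof. by apply: rdual_val_inj => m; rewrite /rdual_val /= -mulrA. Qed.
Lemma rdual_lactDl x y phi :
  rdual_lact (x + y) phi = rdual_lact x phi + rdual_lact y phi.
Proof. by apply: rdual_val_inj => m; exact: mulrDl. Qed.
Lemma rdual_lactDr x phi psi :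
  rdual_lact x (phi + psi) = rdual_lact x phi + rdual_lact x psi.
Proof. by apply: rdual_val_inj => m; exact: mulrDr. Qed.
Lemma rdual_lact_ract x phi g :
  rdual_lact x (ract phi g) = ract (rdual_lact x phi) g.
Proof. by apply: rdual_val_inj. Qed.

Definition rdual : bimodule F G :=
  Bimodule rdual_lact1 rdual_lactM rdual_lactDl rdual_lactDr rdual_lact_ract.

End RightDual.

Definition has_rdim (G F : pzRingType) (M : bimodule G F) (d : nat) : Prop :=
  exists e : 'I_d -> M, forall m : M,
    exists! c : {ffun 'I_d -> F}, m = \sum_i ract (e i) (c i).

(* The k-th term (from k = 0) of the right dimension sequence of M is d; the two
   rings swap at each dualization. *)
Fixpoint rdim_seq_at (k : nat) (G F : pzRingType) (M : bimodule G F) (d : nat)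
    : Prop :=
  if k is k'.+1 then rdim_seq_at k' (rdual M) d else has_rdim M d.

(* s is a (not necessarily minimal) period of the right dimension sequence. *)
Definition rdim_seq_period (G F : pzRingType) (M : bimodule G F) (s : seq nat)
    : Prop :=
  forall k, rdim_seq_at k M (nth 0%N s (k %% size s)).

Section Extension.
Context (G F : pzRingType) (f : {rmorphism G -> F}).

Definition ext_lact (g : G) (m : F^c^o) : F^c^o := f g * (m : F).

Lemma ext_lact1 m : ext_lact 1 m = m.
Proof. by rewrite /ext_lact rmorph1 mul1r. Qed.
Lemma ext_lactM g h m : ext_lact (g * h) m = ext_lact g (ext_lact h m).
Proof. by rewrite /ext_lact rmorphM mulrA. Qed.
Lemma ext_lactDl g h m : ext_lact (g + h) m = ext_lact g m + ext_lact h m.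
Proof. by rewrite /ext_lact rmorphD mulrDl. Qed.
Lemma ext_lactDr g m m' : ext_lact g (m + m') = ext_lact g m + ext_lact g m'.
Proof. by rewrite /ext_lact mulrDr. Qed.
Lemma ext_lact_ract g m x : ext_lact g (ract m x) = ract (ext_lact g m) x.
Proof. exact: (mulrA (f g) (m : F) x). Qed.

(* F as a (G, F)-bimodule through f: g . m . x = f g * m * x. *)
Definition ext_bimodule : bimodule G F :=
  Bimodule ext_lact1 ext_lactM ext_lactDl ext_lactDr ext_lact_ract.

End Extension.

Section Tight.
Context (F G : pzRingType) (n : nat).

(* The row map is i |-> i and the column map is j |-> n - b + j. *)
Definition urblock a b (le_an : (a <= n)%N) (le_bn : (b <= n)%N)
    (A : 'M[G]_n) : 'M[G]_(a, b) :=
  mxsub (widen_ord le_an) (fun j => rev_ord (widen_ord le_bn (rev_ord j))) A.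

Lemma tight_le_row a b : (0 < b)%N -> (a + b = n.+1)%N -> (a <= n)%N.
Proof. by case: b => // b _; rewrite addnS => -[<-]; exact: leq_addr. Qed.

Lemma tight_le_col a b : (0 < a)%N -> (a + b = n.+1)%N -> (b <= n)%N.
Proof. by rewrite addnC; exact: tight_le_row. Qed.

Definition a_tight (phi : F -> 'M[G]_n) (a : nat) : Prop :=
  forall (b : nat) (a_gt0 : (0 < a)%N) (b_gt0 : (0 < b)%N)
         (abn : (a + b = n.+1)%N) (g : 'M[G]_(a, b)),
  exists x : F,
    urblock (tight_le_row b_gt0 abn) (tight_le_col a_gt0 abn) (phi x) = g.

Definition tight (phi : F -> 'M[G]_n) : Prop :=
  forall a : nat, (1 <= a <= n)%N -> a_tight phi a.

End Tight.

(* Main.v *)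
(* Both conditions are equivalent to the existence of an embedding f : G -> F and
   a left G-basis u_0 = 1, ..., u_(n-1) of F, with flag V_a = <u_0, .., u_(a-1)>,
   such that for all a < n every G-linear map V_(a+1) -> F / V_a is a right
   multiplication by an element of F: this is tightness of phi, where phi(x) is
   the matrix of right multiplication by x in the basis u.

   Put K_a = {x | V_a x <= V_(a+1)} and S_a = {x | V_a x <= V_a}; K_a is an
   (S_a, S_(a+1))-bimodule. Up to identification of rings, K_a is the (a+1)-st
   right dual of the (G, F)-bimodule F. Indeed, for some t the elements 1, t form
   a right S_(a+1)-basis of K_a and a left S_(a+1)-basis of K_(a+1), so K_(a+1)
   is the right dual of K_a, with S_(a+2) isomorphic to S_a. From such a t one
   recovers u_(a+1) as u_a t, so the flag is built step by step from the
   dimensions 2; dimension 1 of the last dual means that V_n = F. Conversely,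
   the dual of the last K_(n-1) = F has dimension n over S_(n-1), and its dual is
   F again, whence periodicity. *)
Require Import Defs.
From HB Require Import structures.
From mathcomp Require Import all_boot all_order all_algebra.
From mathcomp Require Import boolp.
From mathcomp Require Import zify.

Set Implicit Arguments.
Unset Strict Implicit.
Unset Printing Implicit Defensive.

Import GRing.Theory.
Local Open Scope ring_scope.

(** * Functionals and morphisms obtained from plain functions *)

Lemma rdual_mk (A B : pzRingType) (M : bimodule A B) (h : M -> B) :
  {morph h : x y / x + y} -> (forall m b, h (ract m b) = h m * b) ->
  exists phi : rdual M, rdual_val phi =1 h.
Proof.
move=> hD hZ.
have hl : linear (h : M -> B^c^o).
  by move=> a u v; rewrite hD -[a *: u]/(ract u a) hZ.
by exists (HB.pack_for {linear M -> B^c^o} (h : M -> B^c^o)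
  (GRing.isLinear.Build _ _ _ _ _ hl)).
Qed.

Lemma rdual_valD (A B : pzRingType) (M : bimodule A B) (phi : rdual M) :
  {morph rdual_val phi : x y / x + y}.
Proof. by move=> x y; rewrite /rdual_val linearD. Qed.

Lemma rdual_val_ract (A B : pzRingType) (M : bimodule A B) (phi : rdual M) m b :
  rdual_val phi (ract m b) = rdual_val phi m * b.
Proof. exact: (linearZ_LR (phi : {linear M -> B^c^o})). Qed.

Lemma mk_additive (U V : zmodType) (h : U -> V) :
  {morph h : x y / x + y} -> exists k : {additive U -> V}, k =1 h.
Proof.
move=> hD.
have h0 : h 0 = 0 by apply: (addrI (h 0)); rewrite -hD !addr0.
have hB : zmod_morphism h.
  move=> x y; apply: (addIr (h y)).
  by rewrite -hD !subrK.
by exists (HB.pack_for {additive U -> V} h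
  (GRing.isZmodMorphism.Build U V h hB)).
Qed.

Lemma mk_rmorphism (U V : pzRingType) (h : U -> V) :
  {morph h : x y / x + y} -> {morph h : x y / x * y} -> h 1 = 1 ->
  exists k : {rmorphism U -> V}, k =1 h.
Proof.
move=> hD hM h1.
have h0 : h 0 = 0 by apply: (addrI (h 0)); rewrite -hD !addr0.
have hB : zmod_morphism h by move=> x y; apply: (addIr (h y)); rewrite -hD !subrK.
have hm : monoid_morphism h by split.
by exists (HB.pack_for {rmorphism U -> V} h
  (GRing.isZmodMorphism.Build U V h hB) (GRing.isMonoidMorphism.Build U V h hm)).
Qed.

Lemma division_rmorph_inj (A B : unitRingType) (h : {rmorphism A -> B}) :
  GRing.field_axiom A -> injective h.
Proof.
move=> divA; apply: raddf_inj => x hx0; apply/eqP; apply: contraT => /divA xu.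
by have := oner_neq0 B; rewrite -(rmorph1 h) -(mulrV xu) rmorphM hx0 mul0r eqxx.
Qed.

(* M is semilinearly isomorphic to the additive subgroup K of F, the two rings
   acting through the subrings S (left) and S' (right) of F. *)
Variant realized (F : pzRingType) (A B : pzRingType) (M : bimodule A B)
    (S S' K : F -> Prop) : Prop :=
  Realized (al : {rmorphism A -> F}) (be : {rmorphism B -> F})
    (ka : {additive M -> F})
  of (forall x, S x <-> exists a, x = al a)
   & (forall x, S' x <-> exists b, x = be b)
   & (forall x, K x <-> exists m, x = ka m)
   & injective ka
   & (forall a m, ka (lact a m) = al a * ka m)
   & (forall m b, ka (ract m b) = ka m * be b).

Lemma division_mul_eq0 (F : unitRingType) (divF : GRing.field_axiom F) (x y : F) :
  x * y = 0 -> x = 0 \/ y = 0.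
Proof.
move=> xy0; have [->|/divF xu] := eqVneq x 0; first by left.
by right; apply: (mulrI xu); rewrite xy0 mulr0.
Qed.

(** * Right bases and the functionals they determine *)

Definition rbasis (A B : pzRingType) (M : bimodule A B) d (e : 'I_d -> M) :=
  (forall m, exists c : 'I_d -> B, m = \sum_i ract (e i) (c i)) /\
  (forall c : 'I_d -> B, \sum_i ract (e i) (c i) = 0 -> forall i, c i = 0).

Section RightBasis.
Context (A B : pzRingType) (M : bimodule A B) (d : nat) (e : 'I_d -> M).

Lemma rbasis_coord_inj (c c' : 'I_d -> B) : rbasis e ->
  \sum_i ract (e i) (c i) = \sum_i ract (e i) (c' i) -> c =1 c'.
Proof.
move=> [_ free] cc' i; apply/eqP; rewrite -subr_eq0; apply/eqP.
apply: (free (fun i => c i - c' i)).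
rewrite (eq_bigr (fun i => ract (e i) (c i) - ract (e i) (c' i))).
  by rewrite sumrB cc' subrr.
by move=> j _; rewrite /ract -scalerBl.
Qed.

Lemma rbasis_has_rdim : rbasis e -> has_rdim M d.
Proof.
move=> eB; exists e => m; have [c mE] := eB.1 m.
have mE' : m = \sum_i ract (e i) ([ffun i => c i] i).
  by rewrite mE; apply: eq_bigr => i _; rewrite ffunE.
exists [ffun i => c i]; split=> // c'; rewrite {1}mE' => cc'.
exact/ffunP/(rbasis_coord_inj eB).
Qed.

Lemma rdual_val_sum (phi : rdual M) (c : 'I_d -> B) :
  rdual_val phi (\sum_i ract (e i) (c i)) = \sum_i rdual_val phi (e i) * c i.
Proof.
rewrite /rdual_val raddf_sum; apply: eq_bigr => i _; exact: rdual_val_ract.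
Qed.

Lemma rdual_ext (phi psi : rdual M) : rbasis e ->
  (forall i, rdual_val phi (e i) = rdual_val psi (e i)) -> phi = psi.
Proof.
move=> [gen _] ee; apply: rdual_val_inj => m; have [c ->] := gen m.
by rewrite !rdual_val_sum; apply: eq_bigr => i _; rewrite ee.
Qed.

(** The functional is [m |-> \sum_i v i * c m i] for a chosen coordinate map [c]; uniqueness of
    coordinates makes [c] additive and right linear. *)
Lemma rdual_basis (v : 'I_d -> B) : rbasis e ->
  exists phi : rdual M, forall i, rdual_val phi (e i) = v i.
Proof.
move=> eB; have /boolp.choice[c cE] := eB.1.
have cP m (c' : 'I_d -> B) : m = \sum_i ract (e i) (c' i) -> c m =1 c'.
  by move=> mE; apply: rbasis_coord_inj => //; rewrite -cE.
have [||phi phiE] := @rdual_mk A B M (fun m => \sum_i v i * c m i).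
- move=> x y /=; rewrite -big_split; apply: eq_bigr => i _ /=.
  rewrite -mulrDr; congr (_ * _); apply: (cP _ (fun i => c x i + c y i)).
  rewrite {1}(cE x) {1}(cE y) -big_split; apply: eq_bigr => j _ /=.
  by rewrite /ract scalerDl.
- move=> m b /=; rewrite mulr_suml; apply: eq_bigr => i _.
  rewrite -mulrA; congr (_ * _); apply: (cP _ (fun i => c m i * b)).
  rewrite {1}(cE m) /ract scaler_sumr; apply: eq_bigr => j _ /=.
  by rewrite scalerA.
exists phi => i; rewrite phiE (bigD1 i) //=.
have ce : c (e i) =1 (fun j => (j == i)%:R).
  apply: cP; rewrite (bigD1 i) //= eqxx /ract scale1r big1 ?addr0 // => j ji.
  by rewrite (negPf ji) scale0r.
rewrite ce eqxx mulr1 big1 ?addr0 // => j ji.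
by rewrite ce (negPf ji) mulr0.
Qed.

End RightBasis.

(** * Duals of realized bimodules of right dimension 1 and 2 *)

Section RealizedDual.
Context (F A B : unitRingType) (divB : GRing.field_axiom B).
Context (M : bimodule A B) (S S' K : F -> Prop).

Lemma realized_rank1 : realized M S S' K -> (forall x, K x <-> S' x) ->
  has_rdim M 1 /\ realized (rdual M) S' S S'.
Proof.
case=> al be ka SP S'P KP ka_inj kaA kaZ KS'.
have be_inj : injective be := division_rmorph_inj divB.
have /KP[m1 km1] : K 1 by apply/KS'/S'P; exists 1; rewrite rmorph1.
have m1B : rbasis (fun _ : 'I_1 => m1).
  split=> [m|c].
    have /KS' /S'P[b bE] : K (ka m) by apply/KP; exists m.
    by exists (fun=> b); rewrite big_ord1; apply: ka_inj; rewrite kaZ -km1 mul1r.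
  rewrite big_ord1 => /(congr1 ka); rewrite kaZ -km1 mul1r raddf0 => /eqP.
  by rewrite raddf_eq0 // => /eqP c0 i; rewrite (ord1 i).
split; first exact: rbasis_has_rdim m1B.
have [|kd kdE] := @mk_additive (rdual M) F (fun phi => be (rdual_val phi m1)).
  by move=> phi psi; rewrite -rmorphD.
apply: (Realized (al := be) (be := al) (ka := kd)) => //.
- move=> x; split=> [/S'P[b ->]|[phi ->]]; last first.
    by apply/S'P; rewrite kdE; eexists.
  by have [phi phiE] := rdual_basis (fun=> b) m1B; exists phi; rewrite kdE (phiE ord0).
- move=> phi psi; rewrite !kdE => /be_inj e.
  by apply: (rdual_ext m1B).
- by move=> b phi; rewrite !kdE -rmorphM.
move=> phi a; rewrite !kdE.
have [c cE] := m1B.1 (lact a m1); rewrite big_ord1 in cE.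
have aE : al a = be (c ord0).
  by have := congr1 ka cE; rewrite kaA kaZ -km1 mulr1 mul1r.
rewrite aE -rmorphM -rdual_val_ract -cE //.
Qed.

(* A functional phi on K = S' + t S' is sent to phi(t) - phi(1) t. For s in S
   with s = a + t b and s t = c + t d, right multiplication by s on functionals
   becomes right multiplication by d - b t, and t (d - b t) = a t - c. *)
Lemma realized_rank2 (K' : F -> Prop) (t : F) :
  realized M S S' K -> ~ S' t ->
  (forall x, K x <-> exists a b, [/\ S' a, S' b & x = a + t * b]) ->
  (forall x, K' x <-> exists a b, [/\ S' a, S' b & x = a + b * t]) ->
  (forall x, S x <-> K x /\ K (x * t)) ->
  has_rdim M 2 /\
  realized (rdual M) S' (fun x => K' x /\ K' (t * x)) K'.
Proof.
case=> al be ka SP S'P KP ka_inj kaA kaZ tS' KE K'E SE.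
have be_inj : injective be := division_rmorph_inj divB.
(* A relation with [y] nonzero would express [t] as an element of [S']. *)
have freer x y : be x + t * be y = 0 -> x = 0 /\ y = 0.
  move=> xy0; have [y0|yn0] := eqVneq y 0.
    split=> //; apply: be_inj; move: xy0.
    by rewrite y0 !rmorph0 mulr0 addr0.
  have yu : be y \is a GRing.unit by apply/rmorph_unit/divB.
  case: tS'; apply/S'P; exists (- x / y); apply: (mulIr yu).
  rewrite -rmorphM divrK ?divB // rmorphN; apply/eqP.
  by rewrite -subr_eq0 opprK addrC xy0.
have freel x y : be x + be y * t = 0 -> x = 0 /\ y = 0.
  move=> xy0; have [y0|yn0] := eqVneq y 0.
    split=> //; apply: be_inj; move: xy0.
    by rewrite y0 !rmorph0 mul0r addr0.
  have yu : be y \is a GRing.unit by apply/rmorph_unit/divB.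
  case: tS'; apply/S'P; exists (y^-1 * - x); apply: (mulrI yu).
  rewrite -rmorphM mulVKr ?divB // rmorphN; apply/eqP.
  by rewrite -subr_eq0 opprK addrC xy0.
have injr x y x' y' : be x + t * be y = be x' + t * be y' -> x = x' /\ y = y'.
  move/eqP; rewrite -subr_eq0 opprD addrACA -mulrBr -!rmorphB => /eqP /freer.
  by case=> /eqP + /eqP; rewrite !subr_eq0 => /eqP -> /eqP ->.
have injl x y x' y' : be x + be y * t = be x' + be y' * t -> x = x' /\ y = y'.
  move/eqP; rewrite -subr_eq0 opprD addrACA -mulrBl -!rmorphB => /eqP /freel.
  by case=> /eqP + /eqP; rewrite !subr_eq0 => /eqP -> /eqP ->.
have {}KE x : K x <-> exists a b, x = be a + t * be b.
  rewrite KE; split=> [[_ [_ [/S'P[a ->] /S'P[b ->] ->]]]|[a [b ->]]].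
    by exists a, b.
  by exists (be a), (be b); split=> //; apply/S'P; eexists.
have {}K'E x : K' x <-> exists a b, x = be a + be b * t.
  rewrite K'E; split=> [[_ [_ [/S'P[a ->] /S'P[b ->] ->]]]|[a [b ->]]].
    by exists a, b.
  by exists (be a), (be b); split=> //; apply/S'P; eexists.
have /KP[m1 km1] : K 1 by apply/KE; exists 1, 0; rewrite rmorph1 rmorph0 mulr0 addr0.
have /KP[mt kmt] : K t by apply/KE; exists 0, 1; rewrite rmorph1 rmorph0 mulr1 add0r.
pose e (i : 'I_2) : M := if i == ord0 then m1 else mt.
have sumE (c : 'I_2 -> B) : ka (\sum_i ract (e i) (c i)) =
    be (c ord0) + t * be (c (lift ord0 ord0)).
  by rewrite big_ord_recl big_ord1 raddfD /= !kaZ /e /= -km1 -kmt mul1r.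
have eB : rbasis e.
  split=> [m|c].
    have /KE[a [b abE]] : K (ka m) by apply/KP; exists m.
    exists (fun i => if i == ord0 then a else b); apply: ka_inj.
    by rewrite sumE.
  move/(congr1 ka); rewrite sumE raddf0 => /freer[c0 c1] i.
  by case: (unliftP ord0 i) => [j|] ->; rewrite ?ord1.
split; first exact: rbasis_has_rdim eB.
(* The pairs [(p g).1] and [(p g).2] are the columns of the matrix of left multiplication by [al g]
   in the right basis 1, [t]; hence [pM] below is a matrix product. *)
have /boolp.choice[p pE] g : exists p : B * B * (B * B),
    al g = be p.1.1 + t * be p.1.2 /\ al g * t = be p.2.1 + t * be p.2.2.
  have /SE[/KE[a [b ab]] /KE[c [d cd]]] : S (al g) by apply/SP; exists g.
  by exists ((a, b), (c, d)).
have pP g a b c d : al g = be a + t * be b -> al g * t = be c + t * be d ->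
    p g = ((a, b), (c, d)).
  case: (p g) (pE g) => [[a' b'] [c' d']] /= [e1 e2].
  by rewrite {1}e1 {1}e2 => /injr[-> ->] /injr[-> ->].
pose rho g := be (p g).2.2 - be (p g).1.2 * t.
have trho g : t * rho g = be (p g).1.1 * t - be (p g).2.1.
  have [e1 e2] := pE g; apply/eqP; rewrite /rho mulrBr subr_eq addrAC eq_sym.
  by rewrite subr_eq mulrA -mulrDl -e1 e2 addrC.
have pD g h : p (g + h) = (((p g).1.1 + (p h).1.1, (p g).1.2 + (p h).1.2),
    ((p g).2.1 + (p h).2.1, (p g).2.2 + (p h).2.2)).
  have [e1 e2] := pE g; have [e1' e2'] := pE h.
  apply: pP; rewrite !rmorphD mulrDr addrACA.
    by rewrite -e1 -e1'.
  by rewrite -e2 -e2' mulrDl.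
have pM g h : p (g * h) =
   (((p g).1.1 * (p h).1.1 + (p g).2.1 * (p h).1.2,
     (p g).1.2 * (p h).1.1 + (p g).2.2 * (p h).1.2),
    ((p g).1.1 * (p h).2.1 + (p g).2.1 * (p h).2.2,
     (p g).1.2 * (p h).2.1 + (p g).2.2 * (p h).2.2)).
  have [e1 e2] := pE g; have [e1' e2'] := pE h.
  apply: pP; rewrite !rmorphD !rmorphM mulrDr addrACA !mulrA -!mulrDl -e1 -e2.
    by rewrite e1' mulrDr mulrA.
  by rewrite -mulrA e2' mulrDr mulrA.
have [|||al' al'E] := @mk_rmorphism A F rho.
- by move=> g h; rewrite /rho pD /= !rmorphD mulrDl opprD addrACA.
- move=> g h.
  have -> : rho g * rho h = be (p g).2.2 * rho h - be (p g).1.2 * (t * rho h).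
    by rewrite {1}/rho mulrBl mulrA.
  rewrite trho /rho pM /= !rmorphD !rmorphM !mulrBr mulrDl !mulrA opprB.
  by rewrite opprD addrACA addrC.
- have -> : rho 1 = be 1 - be 0 * t.
    by rewrite /rho (pP 1 1 0 0 1) //= !rmorph1 rmorph0 ?mulr0 ?addr0 ?mul1r ?add0r ?mulr1.
  by rewrite rmorph1 rmorph0 mul0r subr0.
have [|kd kdE] := @mk_additive (rdual M) F
    (fun phi => be (rdual_val phi mt) - be (rdual_val phi m1) * t).
  move=> phi psi; rewrite -[rdual_val (phi + psi) _]/(rdual_val phi _ + rdual_val psi _).
  rewrite -[rdual_val (phi + psi) m1]/(rdual_val phi m1 + rdual_val psi m1).
  by rewrite !rmorphD mulrDl opprD addrACA.
apply: (Realized (al := be) (be := al') (ka := kd)) => //.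
- move=> x; split=> [[/K'E[d [b' xE]] /K'E[c' [a txE]]]|[g ->]]; last first.
    split; apply/K'E; rewrite al'E.
      by exists (p g).2.2, (- (p g).1.2); rewrite rmorphN mulNr.
    by exists (- (p g).2.1), (p g).1.1; rewrite trho rmorphN addrC.
  (* To invert [rho] at [x = d + b' t] with [t x = c' + a t], take [a - t b']: it lies in [S]
     because its product with [t] is [- c' + t d], and [rho] sends it to [d + b' t]. *)
  have sK : K (be a + t * be (- b')) by apply/KE; exists a, (- b').
  have stE : (be a + t * be (- b')) * t = be (- c') + t * be d.
    rewrite !rmorphN mulrN mulrBl -mulrA; apply/eqP.
    by rewrite subr_eq -addrA -mulrDr -xE txE addrA addNr add0r.
  have /SP[g gE] : S (be a + t * be (- b')).
    by apply/SE; split=> //; rewrite stE; apply/KE; exists (- c'), d.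
  rewrite gE in stE; exists g; rewrite al'E /rho (pP g _ _ _ _ (esym gE) stE) /=.
  by rewrite rmorphN mulNr opprK.
- move=> x; rewrite K'E; split=> [[a [b ->]]|[phi ->]]; last first.
    by rewrite kdE; exists (rdual_val phi mt), (- rdual_val phi m1); rewrite rmorphN mulNr.
  have [phi phiE] := rdual_basis (fun i => if i == ord0 then - b else a) eB.
  exists phi; rewrite kdE -[mt]/(e (lift ord0 ord0)) -[m1]/(e ord0) !phiE /=.
  by rewrite rmorphN mulNr opprK.
- move=> phi psi; rewrite !kdE -!mulNr -!rmorphN => /injl[phit].
  move=> /oppr_inj phi1; apply: (rdual_ext eB) => i.
  by rewrite /e; case: ifP.
- move=> b phi; rewrite !kdE.
  rewrite -[rdual_val (lact b phi) mt]/(b * _) -[rdual_val (lact b phi) m1]/(b * _).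
  by rewrite !rmorphM mulrBr mulrA.
move=> phi g; rewrite !kdE al'E mulrBl -mulrA trho.
have [e1 e2] := pE g.
have g1 : lact g m1 = ract m1 (p g).1.1 + ract mt (p g).1.2.
  by apply: ka_inj; rewrite raddfD /= kaA !kaZ -km1 -kmt mulr1 mul1r.
have gt : lact g mt = ract m1 (p g).2.1 + ract mt (p g).2.2.
  by apply: ka_inj; rewrite raddfD /= kaA !kaZ -km1 -kmt mul1r.
rewrite -[rdual_val (ract phi g) mt]/(rdual_val phi (lact g mt)).
rewrite -[rdual_val (ract phi g) m1]/(rdual_val phi (lact g m1)).
rewrite g1 gt !rdual_valD !rdual_val_ract /rho !rmorphD !rmorphM !mulrBr !mulrDl !mulrA.
by rewrite opprD addrACA addrC opprB.
Qed.
End RealizedDual.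

(** * Normalized bases recovered from the right dimension *)

Section ExtractBasis.
Context (F A B : unitRingType) (divB : GRing.field_axiom B).
Context (M : bimodule A B) (S S' K : F -> Prop).
Hypotheses (MK : realized M S S' K) (K1 : K 1).

(** Writing 1 as a multiple of the generator shows that the generator is the inverse of an element
    of [S']. *)
Lemma realized_rank1_inv x : has_rdim M 1 -> K x -> S' x.
Proof.
case: MK => al be ka SP S'P KP ka_inj kaA kaZ [e eE] /KP[m ->].
have /KP[m1 km1] := K1.
have [c [m1E _]] := eE m1; have [d [mE _]] := eE m.
rewrite !big_ord1 in m1E mE.
have c0 : c ord0 != 0.
  apply/eqP => c0; have := oner_neq0 F; rewrite km1 m1E c0.
  by rewrite /ract scale0r raddf0 eqxx.
apply/S'P; exists ((c ord0)^-1 * d ord0).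
have cu : be (c ord0) \is a GRing.unit by apply/rmorph_unit/divB.
rewrite mE kaZ; move: km1; rewrite m1E kaZ => /(congr1 (fun x => x * (be (c ord0))^-1)).
by rewrite mulrK // mul1r => <-; rewrite rmorphM rmorphV // divB.
Qed.

(** Basis exchange: 1 replaces a basis vector along which it has a nonzero coordinate, and the other
    vector is [t]. *)
Lemma realized_rank2_inv : has_rdim M 2 ->
  exists t, [/\ K t, ~ S' t &
    forall x, K x -> exists a b, [/\ S' a, S' b & x = a + t * b]].
Proof.
case: MK => al be ka SP S'P KP ka_inj kaA kaZ [e eE].
have /KP[m1 km1] := K1.
pose e0 := e ord0; pose e1 := e (lift ord0 ord0).
have gen m : exists a b, m = ract e0 a + ract e1 b.
  have [c [cE _]] := eE m; exists (c ord0), (c (lift ord0 ord0)).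
  by rewrite {1}cE big_ord_recl big_ord1.
have free a b a' b' : ract e0 a + ract e1 b = ract e0 a' + ract e1 b' ->
    a = a' /\ b = b'.
  have [c [_ cU]] := eE (ract e0 a + ract e1 b).
  pose cc x y : {ffun 'I_2 -> B} := [ffun i => if i == ord0 then x else y].
  have ccE x y : ract e0 x + ract e1 y = \sum_i ract (e i) (cc x y i).
    by rewrite big_ord_recl big_ord1 !ffunE.
  move=> ab; have h1 := cU _ (ccE a b); have := cU (cc a' b').
  rewrite -ccE ab h1 => /(_ erefl) /ffunP cab.
  by have := cab ord0; have := cab (lift ord0 ord0); rewrite !ffunE.
have [x [y m1E]] := gen m1.
(* The exchange for an ordered basis [q], [q'], with the coordinate [z] of 1 along [q] nonzero; it
   is applied to one of the two orders of [e0], [e1]. *)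
have main q q' z w : m1 = ract q z + ract q' w -> z != 0 ->
    (forall m, exists a b, m = ract q a + ract q' b) ->
    (forall a b a' b', ract q a + ract q' b = ract q a' + ract q' b' ->
    a = a' /\ b = b') ->
  exists t, [/\ K t, ~ S' t &
    forall x, K x -> exists a b, [/\ S' a, S' b & x = a + t * b]].
  move=> m1E' z0 genq freeq; exists (ka q'); split.
  - by apply/KP; exists q'.
  - move=> /S'P[b bE].
    have q'E : q' = ract m1 b by apply: ka_inj; rewrite kaZ -km1 mul1r.
    have := freeq 0 1 (z * b) (w * b); rewrite /ract scale0r add0r scale1r.
    rewrite {1}q'E m1E' /ract scalerDr !scalerA => /(_ erefl)[/esym zb].
    have [/eqP|->] := division_mul_eq0 divB zb; first by rewrite (negPf z0).
    by rewrite mulr0 => /eqP; rewrite oner_eq0.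
  move=> _ /KP[m ->]; have [a [b ->]] := genq m.
  have zu : be z \is a GRing.unit by apply/rmorph_unit/divB.
  exists (be (z^-1 * a)), (be (b - w * (z^-1 * a))); split.
  - by apply/S'P; eexists.
  - by apply/S'P; eexists.
  have aE : ka q * be a = (1 - ka q' * be w) * be (z^-1 * a).
    by rewrite km1 m1E' raddfD /= !kaZ addrK -mulrA -rmorphM mulVKr ?divB.
  rewrite raddfD /= !kaZ aE rmorphB mulrBl mul1r mulrBr -addrA; congr (_ + _).
  by rewrite addrC; congr (_ - _); rewrite rmorphM mulrA.
have [x0|x0] := eqVneq x 0; last by apply: (main e0 e1 x y).
apply: (main e1 e0 y x); first by rewrite addrC.
- apply/eqP => y0; have := oner_neq0 F; rewrite km1 m1E x0 y0.
  by rewrite /ract !scale0r addr0 raddf0 eqxx.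
- by move=> m; have [a [b ->]] := gen m; exists b, a; rewrite addrC.
by move=> a b a' b'; rewrite addrC [RHS]addrC => /free[].
Qed.

End ExtractBasis.

(** * Flags of left [G]-subspaces of [F], and tightness along them *)

Section Flags.
Context (G F : unitRingType) (divG : GRing.field_axiom G)
  (divF : GRing.field_axiom F) (f : {rmorphism G -> F}).
Implicit Types (u : nat -> F) (a b : nat) (x y v w t : F).

(** This is V_a. Peeling off the last vector suits the inductions along the flag; [span_sum] gives
    the form with coordinates. *)
Fixpoint span u a x : Prop :=
  if a is a'.+1 then exists g, span u a' (x - f g * u a') else x = 0.

Lemma span_0 u a : span u a 0.
Proof. by elim: a => //= a IH; exists 0; rewrite rmorph0 mul0r subr0. Qed.

Lemma spanD u a x y : span u a x -> span u a y -> span u a (x + y).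
Proof.
elim: a x y => [|a IH] x y /=; first by move=> -> ->; rewrite addr0.
move=> [g xg] [h yh]; exists (g + h).
by rewrite rmorphD mulrDl opprD addrACA; apply: IH.
Qed.

Lemma spanZ u a g x : span u a x -> span u a (f g * x).
Proof.
elim: a x => [|a IH] x /=; first by move=> ->; rewrite mulr0.
by move=> [h xh]; exists (g * h); rewrite rmorphM -mulrA -mulrBr; apply: IH.
Qed.

Lemma spanN u a x : span u a x -> span u a (- x).
Proof. by move=> /(spanZ (- 1)); rewrite rmorphN rmorph1 mulN1r. Qed.

Lemma spanB u a x y : span u a x -> span u a y -> span u a (x - y).
Proof. by move=> ux /spanN; apply: spanD. Qed.

Lemma spanB_sym u a x y : span u a (x - y) -> span u a (y - x).
Proof. by move=> /spanN; rewrite opprB. Qed.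

Lemma spanB_trans u a y x z :
  span u a (x - y) -> span u a (y - z) -> span u a (x - z).
Proof. by move=> xy /(spanD xy); rewrite addrA subrK. Qed.

Lemma span_sub u a x y : span u a (x - y) -> span u a y -> span u a x.
Proof. by move=> xy /(spanD xy); rewrite subrK. Qed.

Lemma spanS u a x : span u a x -> span u a.+1 x.
Proof. by exists 0; rewrite rmorph0 mul0r subr0. Qed.

Lemma span_gen u a i : (i < a)%N -> span u a (u i).
Proof.
elim: a => // a IH; rewrite ltnS leq_eqVlt => /predU1P[->|/IH]; last exact: spanS.
by exists 1; rewrite rmorph1 mul1r subrr; apply: span_0.
Qed.

Lemma span_eq u u' a : (forall i, (i < a)%N -> u i = u' i) -> span u a = span u' a.
Proof.
elim: a => // a IH uu'; apply/funext => x; apply/propext => /=.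
by rewrite IH => [|i ia]; [rewrite uu' | apply: uu'; exact: ltnW].
Qed.

(** In the notation V, K, S, [hom u a a] is S_a and [hom u a a.+1] is K_a. Testing on generators is
    enough by [hom_span]. *)
Definition hom u a b x := forall i, (i < a)%N -> span u b (u i * x).

(* Every G-linear map from span u a.+1 to F / span u a is a right
   multiplication by an element of F. *)
Definition tight_at u a := forall c : nat -> F,
  exists x, forall i, (i <= a)%N -> span u a (u i * x - c i).

Lemma hom_eq u u' a b : (forall i, (i < maxn a b)%N -> u i = u' i) ->
  hom u a b = hom u' a b.
Proof.
move=> uu'; apply/funext => x; apply/propext; split=> h i ia.
  rewrite -(span_eq (u := u)) => [|j jb]; last by apply: uu'; rewrite leq_max jb orbT.
  by rewrite -uu' ?leq_max ?ia //; apply: h.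
rewrite (span_eq (u' := u')) => [|j jb]; last by apply: uu'; rewrite leq_max jb orbT.
by rewrite uu' ?leq_max ?ia //; apply: h.
Qed.

Lemma tight_at_eq u u' a : (forall i, (i <= a)%N -> u i = u' i) ->
  tight_at u a -> tight_at u' a.
Proof.
move=> uu' ua c; have [x xP] := ua c; exists x => i ia.
rewrite -(span_eq (u := u)) => [|j ja]; last exact/uu'/ltnW.
by rewrite -uu' //; apply: xP.
Qed.

(* The constant d is the value at v of the G-linear map u_j |-> c_j, for one
   choice of coordinates of v. *)
Lemma span_lift u a b (c : nat -> F) v : span u b v -> exists d, forall y,
  (forall j, (j < b)%N -> span u a (u j * y - c j)) -> span u a (v * y - d).
Proof.
elim: b v => [|b IH] v /=; first
  by move=> ->; exists 0 => y _; rewrite mul0r subr0; apply: span_0.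
move=> [g /IH[d dP]]; exists (d + f g * c b) => y yP.
have /(spanZ g) h1 := yP b (ltnSn b).
have h2 := dP y (fun j jb => yP j (ltnW jb)).
have := spanD h1 h2; rewrite mulrBr mulrBl mulrA.
by rewrite addrACA addrC [_ + (_ - _)]addrC subrK -opprD addrC [d + _]addrC.
Qed.

Lemma hom_span u a b x v : hom u a b x -> span u a v -> span u b (v * x).
Proof.
move=> hx; elim: a v hx => [|a IH] v hx /=; first
  by move=> ->; rewrite mul0r; apply: span_0.
move=> [g vg]; rewrite -(subrK (f g * u a) v) mulrDl -mulrA; apply: spanD.
  by apply: IH => // i ia; apply: hx; exact: ltnW.
exact/spanZ/hx.
Qed.

Lemma homM u a b c x y : hom u a b x -> hom u b c y -> hom u a c (x * y).
Proof. by move=> hx hy i ia; rewrite mulrA; apply: hom_span hy _; apply: hx. Qed.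

Lemma homD u a b x y : hom u a b x -> hom u a b y -> hom u a b (x + y).
Proof. by move=> hx hy i ia; rewrite mulrDr; apply: spanD; [apply: hx|apply: hy]. Qed.

Lemma homSl u a b x : hom u a.+1 b x -> hom u a b x.
Proof. by move=> hx i ia; apply: hx; exact: ltnW. Qed.

Lemma homSr u a b x : hom u a b x -> hom u a b.+1 x.
Proof. by move=> hx i ia; apply/spanS/hx. Qed.

Lemma homSS u a b x : hom u a b x -> span u b (u a * x) -> hom u a.+1 b x.
Proof.
by move=> hx ha i; rewrite ltnS leq_eqVlt => /predU1P[->|/hx].
Qed.

Lemma hom_1 u a : hom u a a 1.
Proof. by move=> i ia; rewrite mulr1; apply: span_gen. Qed.

(* hom u a a.+1 is a right vector space with basis (1, t) over the stabilizer
   of span u a.+1. *)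
Definition splits u a t := [/\ hom u a a.+1 t,
  span u a.+1 (u a * t - u a.+1) &
  forall x, hom u a a.+1 x ->
    exists y z, [/\ hom u a.+1 a.+1 y, hom u a.+1 a.+1 z & x = y + t * z]].

(** Modulo V_(a+1), tightness gives [t] with [u a * t] congruent to [u a.+1], and for [x] in K_a an
    [s] in S_(a+1) with [u a.+1 * s] congruent to [u a * x]. Then [x - t * s] also sends [u a] into
    V_(a+1). *)
Lemma tight_splits u a : tight_at u a.+1 -> exists t, splits u a t.
Proof.
move=> ua; have [t tP] := ua (fun i => if i == a then u a.+1 else 0).
have ht : hom u a a.+1 t.
  by move=> i ia; have := tP i (leqW (ltnW ia)); rewrite ltn_eqF // subr0.
have htu : span u a.+1 (u a * t - u a.+1) by have := tP a (leqnSn a); rewrite eqxx.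
exists t; split=> // x hx.
have [s sP] := ua (fun i => if i == a.+1 then u a * x else 0).
have hs : hom u a.+1 a.+1 s.
  by move=> i ia; have := sP i (ltnW ia); rewrite ltn_eqF // subr0.
exists (x - t * s), s; split=> //; last by rewrite subrK.
apply: homSS.
  by move=> i ia; rewrite mulrBr mulrA; apply: spanB (hx _ ia) (hom_span hs (ht _ ia)).
have := sP a.+1 (leqnn _); rewrite eqxx => /spanB_sym h.
rewrite mulrBr; apply: (spanB_trans h).
by rewrite mulrA -mulrBl -opprB mulNr; apply/spanN/(hom_span hs).
Qed.

(** A solution [x1] on V_(a+1) is corrected so as to be right at [u a.+1 = u a * t]. Modulo V_a,
    [x2] agrees with [t * x1] on V_a and sends [u a] to [c a.+1]. So [t * x1 - x2] lies in K_a, and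
    if it is [y + t * z] then [x1 - z] is a solution. *)
Lemma splits_tight u a t : u a.+1 = u a * t -> splits u a t ->
  tight_at u a -> tight_at u a.+1.
Proof.
move=> utE [ht _ hK] ua c; have [x1 x1P] := ua c.
(* For [i < a] the vector [u i * t] lies in V_(a+1), so its image modulo V_a depends only on [c];
   other indices get the dummy value 0. *)
have /boolp.choice[d dP] i : exists d, (i < a)%N -> forall y,
  (forall j, (j < a.+1)%N -> span u a (u j * y - c j)) -> span u a (u i * t * y - d).
  have [ia|] := boolP (i < a)%N; last by exists 0.
  by have [d dP] := span_lift a c (ht i ia); exists d.
have [x2 x2P] := ua (fun i => if i == a then c a.+1 else d i).
have /hK[y [z [hy hz e]]] : hom u a a.+1 (t * x1 - x2).
  move=> i ia; apply: spanS; rewrite mulrBr mulrA; apply: (@spanB_trans _ _ (d i)).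
    exact: dP.
  by have := x2P i (ltnW ia); rewrite ltn_eqF // => /spanB_sym.
exists (x1 - z) => i; rewrite leq_eqVlt => /predU1P[->|ia].
  rewrite utE mulrBr -!mulrA.
  have -> : t * x1 = x2 + y + t * z by rewrite -addrA -e addrC subrK.
  rewrite !mulrDr addrK addrAC; apply: spanD (hy a _) => //.
  by apply: spanS; have := x2P a (leqnn a); rewrite eqxx.
rewrite mulrBr addrAC; apply: spanB (hz _ ia); apply: spanS; exact: x1P.
Qed.

(** * The dual of K_a is K_(a+1) *)

Section DualStep.
Context (A B : unitRingType) (divB : GRing.field_axiom B) (M : bimodule A B).

Lemma splits_rdual u a t :
    realized M (hom u a a) (hom u a.+1 a.+1) (hom u a a.+1) ->
    tight_at u a -> splits u a t -> ~ span u a.+1 (u a.+1) ->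
  has_rdim M 2 /\
  realized (rdual M) (hom u a.+1 a.+1) (hom u a.+2 a.+2) (hom u a.+1 a.+2).
Proof.
move=> MK ua [ht htu hK] indep.
have ht' : hom u a.+1 a.+2 t.
  apply: homSS; first exact: homSr.
  by apply: (span_sub (spanS htu)); apply: span_gen.
(* Modulo V_(a+1), [u a.+1] is [u a * t], so stability at the new vector is a condition on
   [t * x]. *)
have -> : hom u a.+2 a.+2 = (fun x => hom u a.+1 a.+2 x /\ hom u a.+1 a.+2 (t * x)).
  apply/funext => x; apply/propext; split=> [hx|[hx htx]].
    by split; [exact: homSl|exact: homM hx].
  apply: homSS => //; apply: (@span_sub _ _ _ (u a * (t * x))); last exact: htx.
  by rewrite mulrA -mulrBl; apply: hom_span hx _; exact: spanB_sym.
apply: (realized_rank2 divB MK (t := t)).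
- move=> /(_ a (ltnSn a)) h; apply: indep.
  by apply: (span_sub (spanB_sym htu)).
- move=> x; split=> [/hK //|[y [z [hy hz ->]]]].
  by apply: homD; [exact: homSl|exact: homM hz].
- move=> x; split=> [hx|[y [z [hy hz ->]]]]; last first.
    by apply: homD; [exact: homSr|exact: homM hz ht'].
  (* The scalars [g i] are the [u a.+1]-components of [u i * x]. Tightness at [a] moves them to
     [u a], giving [s] for which [s * t] has the same components as [x]. *)
  have /boolp.choice[g gP] i : exists g,
      (i < a.+1)%N -> span u a.+1 (u i * x - f g * u a.+1).
    have [ia|] := boolP (i < a.+1)%N; last by exists 0.
    by have [g gP] := hx i ia; exists g.
  have [s sP] := ua (fun i => f (g i) * u a).
  have hs : hom u a.+1 a.+1 s by move=> i ia; exists (g i); apply: sP.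
  exists (x - s * t), s; split=> //; last by rewrite subrK.
  move=> i ia; rewrite mulrBr; apply: (spanB_trans (gP i ia)).
  apply: (@spanB_trans _ _ (f (g i) * (u a * t))).
    by rewrite -mulrBr; apply/spanZ/spanB_sym.
  by rewrite !mulrA -mulrBl; apply: hom_span ht _; apply/spanB_sym/sP.
move=> s; split=> [hs|[hs hst] i ia].
  by split; [exact: homSr|exact: homM ht].
(* If the [u a]-component [g] of [u i * s] were nonzero, multiplying by [t] would put [u a.+1] in
   V_(a+1). *)
have [g gP] := hs i ia.
suff g0 : g = 0 by move: gP; rewrite g0 rmorph0 mul0r subr0.
apply/eqP; apply: contraT => /divG gu; case: indep.
rewrite -(mulKr (rmorph_unit f gu) (u a.+1)) -rmorphV //; apply: spanZ.
apply: (@span_sub _ _ _ (f g * (u a * t))).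
  by rewrite -mulrBr; apply/spanZ/spanB_sym.
apply: (@span_sub _ _ _ (u i * s * t)); last by rewrite -mulrA; apply: hst.
by rewrite mulrA -mulrBl; apply: hom_span ht _; apply: spanB_sym.
Qed.

End DualStep.

(** * Tight flags, and their construction from the dimension sequence *)

Definition tight_flag u n := [/\ u 0%N = 1, forall x, span u n x,
  forall i, (i < n)%N -> ~ span u i (u i) & forall a, (a < n)%N -> tight_at u a].

Lemma realized_ext : realized (ext_bimodule f) (fun x => exists g, x = f g)
  (fun=> True) (fun=> True).
Proof.
have [//|ka kaE] := @mk_additive (ext_bimodule f) F (fun x => x).
apply: (Realized (al := f) (be := idfun) (ka := ka)) => //.
- by move=> x; split=> // _; exists x.
- by move=> x; split=> // _; exists x; rewrite kaE.
- by move=> x y; rewrite !kaE.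
- by move=> g x; rewrite !kaE.
by move=> x y; rewrite !kaE.
Qed.

Lemma hom_0 u b : hom u 0 b = fun=> True.
Proof. by apply/funext => x; apply/propext; split. Qed.

Lemma hom_11 u : u 0%N = 1 -> hom u 1 1 = fun x => exists g, x = f g.
Proof.
move=> u0; apply/funext => x; apply/propext; split=> [/(_ 0%N isT)[g /=]|[g ->]].
  by rewrite u0 mul1r mulr1 => /eqP; rewrite subr_eq0 => /eqP ->; exists g.
by move=> [|//] _; exists g => /=; rewrite u0 mul1r mulr1 subrr.
Qed.

Lemma hom_full u a b : (forall x, span u b x) -> hom u a b = fun=> True.
Proof. by move=> full; apply/funext => x; apply/propext; split=> // _ i _. Qed.

Lemma tight_at0 u : u 0%N = 1 -> tight_at u 0.
Proof. by move=> u0 c; exists (c 0%N) => -[|//] _; rewrite u0 mul1r /= subrr. Qed.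

Lemma flag_of_rdims n : (0 < n)%N ->
  rdim_seq_at n (ext_bimodule f) 1 ->
  (forall k, (0 < k < n)%N -> rdim_seq_at k (ext_bimodule f) 2) ->
  exists u, tight_flag u n.
Proof.
move=> n0 dim1 dim2.
(* Invariant: [M] realizes K_a, and its dimension sequence is that of the extension from term [a.+1]
   on. *)
have chain a : (a < n)%N -> exists u, [/\ u 0%N = 1,
    forall i, (i <= a)%N -> ~ span u i (u i),
    forall i, (i <= a)%N -> tight_at u i &
    exists (A B : unitRingType) (M : bimodule A B),
      [/\ GRing.field_axiom A, GRing.field_axiom B,
      realized M (hom u a a) (hom u a.+1 a.+1) (hom u a a.+1) &
      forall k d, rdim_seq_at (a.+1 + k) (ext_bimodule f) d -> rdim_seq_at k M d]].
  elim: a => [|a IH] an.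
    exists (fun=> 1); split=> // [i||].
    - by rewrite leqn0 => /eqP -> /= /eqP; rewrite oner_eq0.
    - by move=> i; rewrite leqn0 => /eqP ->; apply: tight_at0.
    exists F, G, (rdual (ext_bimodule f)); split=> //.
    rewrite hom_11 // !hom_0.
    by have [] := realized_rank1 divF realized_ext.
  have [u [u0 indep tu [A [B [M [dA dB MK Md]]]]]] := IH (ltnW an).
  have K1 : hom u a a.+1 1 by apply/homSr/hom_1.
  have [|t [ht tS hK]] := realized_rank2_inv dB MK K1.
    by apply: (Md 0%N); rewrite addn0; apply: dim2.
  (* The flag is extended by [u a * t]; earlier vectors, and what depends only on them, are
     unchanged. *)
  pose u' i := if i == a.+1 then u a * t else u i.
  have uu' i : (i <= a)%N -> u i = u' i by move=> ia; rewrite /u' ltn_eqF.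
  have homE b c : (b <= a.+1)%N -> (c <= a.+1)%N -> hom u b c = hom u' b c.
    move=> ba ca; apply: hom_eq => i; rewrite leq_max => ibc; apply: uu'.
    by rewrite -ltnS; case/orP: ibc => /leq_trans; apply.
  have spanE b : (b <= a.+1)%N -> span u b = span u' b.
    by move=> ba; apply: span_eq => i ib; apply: uu'; rewrite -ltnS (leq_trans ib).
  have u'a : u' a.+1 = u' a * t by rewrite /u' eqxx ltn_eqF.
  have sp : splits u' a t.
    split; first by rewrite -homE.
      by rewrite u'a subrr; apply: span_0.
    by move=> x; rewrite -!homE //; exact: hK.
  have tu' i : (i <= a)%N -> tight_at u' i.
    move=> ia; apply: tight_at_eq (tu i ia) => j ji; apply: uu'.
    exact: leq_trans ji ia.
  have indep' : ~ span u' a.+1 (u' a.+1).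
    rewrite -spanE // u'a -uu' // => h; apply: tS; exact: homSS.
  rewrite !homE // in MK.
  have [_ MK'] := splits_rdual dB MK (tu' a (leqnn a)) sp indep'.
  exists u'; split.
  - by rewrite -uu'.
  - move=> i; rewrite leq_eqVlt => /predU1P[->//|ia].
    by rewrite -spanE 1?ltnW // -uu' //; apply: indep.
  - move=> i; rewrite leq_eqVlt => /predU1P[->|ia]; last exact: tu'.
    exact: splits_tight u'a sp (tu' a (leqnn a)).
  exists B, A, (rdual M); split=> // k d.
  by rewrite addSnnS => /Md.
case: n n0 dim1 dim2 chain => // m _ dim1 dim2 /(_ m (ltnSn m)).
move=> [u [u0 indep tu [A [B [M [dA dB MK Md]]]]]]; exists u; split=> // w.
(* Dimension 1 of K_m forces K_m into S_(m+1). An [x] in S_m sending [u m] to [w] modulo V_m thus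
   shows that [w] lies in V_(m+1). *)
have [x xP] := tu m (leqnn m) (fun i => if i == m then w else 0).
have hx : hom u m m x.
  by move=> i im; have := xP i (ltnW im); rewrite ltn_eqF // subr0.
have M1 : has_rdim M 1 by apply: (Md 0%N); rewrite addn0.
have K1 : hom u m m.+1 1 by apply/homSr/hom_1.
have := realized_rank1_inv dB MK K1 M1 (homSr hx).
move=> /(_ m (ltnSn m)); apply: span_sub; apply/spanS/spanB_sym.
by have := xP m (leqnn m); rewrite eqxx.
Qed.

(** * Coordinates, and the tight embedding given by a flag *)

Lemma span_sum u n x : span u n x <-> exists c : 'I_n -> G, x = \sum_i f (c i) * u i.
Proof.
elim: n x => [|n IH] x /=.
  by split=> [->|[c ->]]; [exists (fun=> 0)|]; rewrite big_ord0.
split=> [[g /IH[c xE]]|[c ->]].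
  exists (fun i => oapp c g (unlift ord_max i)); rewrite big_ord_recr /= unlift_none /=.
  rewrite -[LHS](subrK (f g * u n)) xE; congr (_ + _); apply: eq_bigr => i _.
  suff -> : widen_ord (leqnSn n) i = lift ord_max i by rewrite liftK.
  by apply: val_inj; rewrite /= /bump leqNgt ltn_ord.
exists (c ord_max); apply/IH; exists (fun i => c (widen_ord (leqnSn n) i)).
by rewrite big_ord_recr /= addrK.
Qed.

Lemma indep_coord u n (c : 'I_n -> G) : (forall i, (i < n)%N -> ~ span u i (u i)) ->
  \sum_i f (c i) * u i = 0 -> forall i, c i = 0.
Proof.
elim: n c => [|n IH] c indep; first by move=> _ [].
rewrite big_ord_recr /= => e.
have cn : c ord_max = 0.
  apply/eqP; apply: contraT => /divG cu; case: (indep n (ltnSn n)).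
  rewrite -(mulKr (rmorph_unit f cu) (u n)) -rmorphV //; apply: spanZ.
  rewrite -[_ * _]opprK; apply: spanN; apply/span_sum.
  exists (fun i => c (widen_ord (leqnSn n) i)).
  by apply/eqP; rewrite eq_sym -addr_eq0 e.
move: e; rewrite cn rmorph0 mul0r addr0 => /IH h i.
case: (unliftP ord_max i) => [j|] -> //.
have -> : lift ord_max j = widen_ord (leqnSn n) j.
  by apply: val_inj; rewrite /= /bump leqNgt ltn_ord.
by apply: h => k kn; apply: indep; exact: leqW.
Qed.

(** Column [j] of the corner block is column [a.-1 + j] of the matrix. So the block describes a map
    from V_a to F / V_(a-1), and [a]-tightness corresponds to [tight_at u a.-1]. *)
Lemma rev_ord_index n a b j : (0 < a)%N -> (a + b = n.+1)%N -> (j < b)%N ->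
  (n - (b - j.+1).+1 = a.-1 + j)%N.
Proof. lia. Qed.

Lemma tight_embedding_of_flag u n : (0 < n)%N -> tight_flag u n ->
  exists2 phi : {rmorphism F -> 'M[G]_n}, injective phi & tight phi.
Proof.
move=> n0 [u0 full indep tu].
have /boolp.choice[co coE] x : exists c : 'I_n -> G, x = \sum_i f (c i) * u i.
  exact/span_sum.
have coU x (c : 'I_n -> G) : x = \sum_i f (c i) * u i -> co x =1 c.
  move=> xE i; apply/eqP; rewrite -subr_eq0; apply/eqP.
  apply: (indep_coord (c := fun i => co x i - c i) indep).
  rewrite (eq_bigr (fun i => f (co x i) * u i - f (c i) * u i)).
    by rewrite sumrB -coE -xE subrr.
  by move=> j _; rewrite rmorphB mulrBl.
have coD x y i : co (x + y) i = co x i + co y i.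
  apply: (coU _ (fun i => co x i + co y i)); rewrite {1}(coE x) {1}(coE y) -big_split.
  by apply: eq_bigr => j _; rewrite rmorphD mulrDl.
have coZ g x i : co (f g * x) i = g * co x i.
  apply: (coU _ (fun i => g * co x i)); rewrite {1}(coE x) mulr_sumr.
  by apply: eq_bigr => j _; rewrite rmorphM mulrA.
have cou (i j : 'I_n) : co (u i) j = (i == j)%:R.
  apply: (coU _ (fun j => (i == j)%:R)); rewrite (bigD1 i) //= eqxx rmorph1 mul1r.
  by rewrite big1 ?addr0 // => k; rewrite eq_sym => /negPf ->; rewrite rmorph0 mul0r.
have co_sum I (r : seq I) (h : I -> F) j :
    co (\sum_(i <- r) h i) j = \sum_(i <- r) co (h i) j.
  elim: r => [|i r IH]; last by rewrite !big_cons coD IH.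
  by rewrite !big_nil; apply: (addrI (co 0 j)); rewrite -coD !addr0.
have [|||phi phiE] := @mk_rmorphism F 'M[G]_n (fun x => \matrix_(i, j) co (u i * x) j).
- by move=> x y; apply/matrixP => i j; rewrite !mxE mulrDr coD.
- move=> x y; apply/matrixP => i j; rewrite !mxE mulrA {1}(coE (u i * x)).
  rewrite mulr_suml co_sum; apply: eq_bigr => k _.
  by rewrite -mulrA coZ !mxE.
- by apply/matrixP => i j; rewrite !mxE mulr1 cou.
exists phi.
  (* As [u 0 = 1], the first row of [phi x] lists the coordinates of [x] itself. *)
  apply: raddf_inj => x phix0; have /matrixP {}phix0 : phi x = 0 := phix0.
  rewrite (coE x) big1 // => j _; have := phix0 (Ordinal n0) j.
  by rewrite phiE !mxE /= u0 mul1r => ->; rewrite rmorph0 mul0r.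
move=> a /andP[a_gt0 an] b a0 b0 abn g.
have an1 : (a.-1 < n)%N by rewrite prednK.
pose sh (j : 'I_b) := rev_ord (widen_ord (tight_le_col a0 abn) (rev_ord j)).
have shE j : sh j = (a.-1 + j)%N :> nat := rev_ord_index a0 abn (ltn_ord j).
have co0 k y (j : 'I_n) : span u k y -> (k <= j)%N -> co y j = 0.
  elim: k y => [|k IH] y /=; first
    by move=> -> _; apply: (addrI (co 0 j)); rewrite -coD !addr0.
  move=> [h yh] kj; have := coD (y - f h * u k) (f h * u k) j.
  rewrite subrK coZ (IH _ yh (ltnW kj)) add0r => ->.
  have kn : (k < n)%N := ltn_trans kj (ltn_ord j).
  have := cou (Ordinal kn) j; rewrite -val_eqE /= => ->.
  by rewrite ltn_eqF // mulr0.
(* Row [i] of [g] is turned into an element of F with these coordinates in the block columns;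
   indices outside the block get 0. *)
pose c i := if insub i is Some i' then \sum_j f (g i' j) * u (sh j) else 0.
have [x xP] := tu a.-1 an1 c; exists x; apply/matrixP => i j.
rewrite mxE phiE mxE.
have ia : (i <= a.-1)%N by rewrite -ltnS prednK.
have sj : (a.-1 <= sh j)%N by rewrite shE leq_addr.
have := co0 _ _ _ (xP i ia) sj.
have -> : c i = \sum_j f (g i j) * u (sh j)
  by rewrite /c; case: insubP (ltn_ord i) => [i' _ /val_inj ->|/negPf ->].
move=> e; rewrite -[u _ * x](subrK (\sum_j f (g i j) * u (sh j))) coD e add0r.
rewrite co_sum (bigD1 j) // coZ cou eqxx mulr1 big1 => [|k kj]; first exact: addr0.
have /negPf skj : sh k != sh j.
  apply: contra_neq kj => /(congr1 (@nat_of_ord n)).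
  by rewrite !shE => /addnI /val_inj.
by rewrite coZ cou skj mulr0.
Qed.

(** * The last dual, and periodicity of the dimension sequence *)

Section LastDual.
Context (A B : unitRingType) (divB : GRing.field_axiom B) (M : bimodule A B).

(* Writing la(x) for the last coordinate of x in the basis u, the pairing
   (x, y) |-> la(x y) identifies F with its dual over hom u m m. *)
Lemma flag_rdual u m : tight_flag u m.+1 ->
  realized M (fun=> True) (hom u m m) (fun=> True) ->
  has_rdim M m.+1 /\
  realized (rdual M) (fun x => exists g, x = f g) (fun=> True) (fun=> True).
Proof.
move=> [u0 full indep tu] [al be ka SP S'P KP ka_inj kaA kaZ].
have indep_m := indep m (ltnSn m); have tu_m := tu m (ltnSn m).
have /boolp.choice[la laP] x : exists g, span u m (x - f g * u m) by exact: full.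
have laU x g : span u m (x - f g * u m) -> la x = g.
  move=> xg; apply/eqP; rewrite -subr_eq0; apply: contraT => /divG cu.
  case: indep_m; rewrite -(mulKr (rmorph_unit f cu) (u m)) -rmorphV //.
  apply: spanZ; rewrite rmorphB mulrBl.
  by apply: (spanB_trans _ xg); apply: spanB_sym; apply: laP.
have la0 x : la x = 0 -> span u m x.
  by move=> e; have := laP x; rewrite e rmorph0 mul0r subr0.
have laD x y : la (x + y) = la x + la y.
  by apply: laU; rewrite rmorphD mulrDl opprD addrACA; apply: spanD.
have laZ g x : la (f g * x) = g * la x.
  by apply: laU; rewrite rmorphM -mulrA -mulrBr; apply: spanZ.
have lau : la (u m) = 1.
  by apply: laU; rewrite rmorph1 mul1r subrr; apply: span_0.
have be_hom (b : B) : hom u m m (be b) by apply/S'P; exists b.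
have laM x (b : B) : la (x * be b) = la x * la (u m * be b).
  apply: laU; apply: (@spanB_trans _ _ (f (la x) * (u m * be b))).
    by rewrite mulrA -mulrBl; apply: hom_span (be_hom b) (laP x).
  by rewrite rmorphM -mulrA -mulrBr; apply/spanZ/laP.
have la_sum I (r : seq I) (h : I -> F) :
    la (\sum_(i <- r) h i) = \sum_(i <- r) la (h i).
  elim: r => [|i r IH]; last by rewrite !big_cons laD IH.
  by rewrite !big_nil; apply: (addrI (la 0)); rewrite -laD !addr0.
(* S_m preserves V_m, hence acts on the line F / V_m spanned by [u m]. This action is [ga], onto [G]
   by tightness at [m]. *)
have [|||ga gaE] := @mk_rmorphism B G (fun b : B => la (u m * be b)).
- by move=> b c; rewrite rmorphD mulrDr laD.
- by move=> b c; rewrite rmorphM mulrA laM.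
- by rewrite rmorph1 mulr1.
have {}laM x (b : B) : la (x * be b) = la x * ga b by rewrite gaE laM.
have ga_inj : injective ga := division_rmorph_inj divB.
have ga_surj g : exists b : B, ga b = g.
  have [s sP] := tu_m (fun i => if i == m then f g * u m else 0).
  have /S'P[b bE] : hom u m m s.
    by move=> i im; have := sP i (ltnW im); rewrite ltn_eqF // subr0.
  exists b; rewrite gaE -bE; apply: laU.
  by have := sP m (leqnn m); rewrite eqxx.
(* An invertible such [z] would give F = F z inside V_m, against independence of [u m]. *)
have nondeg_r z : (forall j, (j <= m)%N -> la (u j * z) = 0) -> z = 0.
  move=> zP; apply/eqP; apply: contraT => /divF zu; case: indep_m.
  rewrite -(mulrVK zu (u m)); apply: (@hom_span _ m.+1) (full _) => j jm.
  exact/la0/zP.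
have nondeg_l x : (forall y, la (x * y) = 0) -> x = 0.
  move=> xP; apply/eqP; apply: contraT => /divF xu.
  by have := xP (x^-1 * u m); rewrite mulVKr // lau => /eqP; rewrite oner_eq0.
have kaS x : exists m, x = ka m by apply/KP.
(* Tightness at [m] yields the basis dual to [u] for the pairing. *)
have /boolp.choice[e eP] (i : 'I_m.+1) : exists e : M,
    forall j, (j <= m)%N -> la (u j * ka e) = (j == i)%:R.
  have [x xP] := tu_m (fun j => if j == i then u m else 0).
  have [e xE] := kaS x; exists e => j jm; rewrite -xE; apply: laU.
  by have := xP j jm; case: (j == i); rewrite ?rmorph1 ?mul1r // rmorph0 mul0r.
have la_e (i j : 'I_m.+1) : la (u j * ka (e i)) = (j == i)%:R.
  exact: eP (ltn_ord j).
have la_basis (c : 'I_m.+1 -> B) (j : 'I_m.+1) :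
    la (u j * ka (\sum_i ract (e i) (c i))) = ga (c j).
  rewrite raddf_sum mulr_sumr la_sum (bigD1 j) //= kaZ mulrA laM la_e eqxx mul1r.
  by rewrite big1 ?addr0 // => i; rewrite eq_sym kaZ mulrA laM la_e => /negPf ->;
     rewrite mul0r.
have eB : rbasis e.
  split=> [z|c /(congr1 ka) c0 i]; last first.
    apply: ga_inj; rewrite -la_basis c0 raddf0 mulr0 rmorph0.
    by apply: (addrI (la 0)); rewrite -laD !addr0.
  have /boolp.choice[c cP] (j : 'I_m.+1) := ga_surj (la (u j * ka z)).
  exists c; apply: ka_inj; apply/eqP; rewrite -subr_eq0; apply/eqP.
  apply: nondeg_r => j jm.
  have := la_basis c (Ordinal (jm : (j < m.+1)%N)); rewrite cP /= => h.
  apply: (addIr (la (u j * ka (\sum_i ract (e i) (c i))))).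
  by rewrite -laD -mulrDr subrK add0r h.
split; first exact: rbasis_has_rdim eB.
have /boolp.choice[kd kdP] (phi : rdual M) :
    exists x, forall z, la (x * ka z) = ga (rdual_val phi z).
  exists (\sum_i f (ga (rdual_val phi (e i))) * u i) => z.
  have [c ->] := eB.1 z; rewrite rdual_val_sum rmorph_sum mulr_suml la_sum.
  by apply: eq_bigr => i _; rewrite -mulrA laZ la_basis rmorphM.
have kdU phi x : (forall z, la (x * ka z) = ga (rdual_val phi z)) -> kd phi = x.
  move=> xP; apply/eqP; rewrite -subr_eq0; apply/eqP; apply: nondeg_l => y.
  have [z ->] := kaS y; apply: (addIr (la (x * ka z))).
  by rewrite -laD -mulrDl subrK add0r xP kdP.
have [|kd' kdE] := @mk_additive (rdual M) F kd.
  by move=> phi psi; apply: kdU => z; rewrite mulrDl laD !kdP -rmorphD.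
have [|||fg fgE] := @mk_rmorphism B F (fun b : B => f (ga b)).
- by move=> b c; rewrite !rmorphD.
- by move=> b c; rewrite !rmorphM.
- by rewrite !rmorph1.
apply: (Realized (al := fg) (be := al) (ka := kd')).
- move=> x; split=> [[g ->]|[b ->]]; last by exists (ga b); rewrite fgE.
  by have [b <-] := ga_surj g; exists b; rewrite fgE.
- exact: SP.
- move=> x; split=> // _.
  have /boolp.choice[c cP] i := ga_surj (la (x * ka (e i))).
  have [phi phiE] := rdual_basis c eB; exists phi; rewrite kdE; apply/esym/kdU => z.
  have [d ->] := eB.1 z; rewrite rdual_val_sum rmorph_sum raddf_sum mulr_sumr la_sum.
  by apply: eq_bigr => i _; rewrite kaZ mulrA laM rmorphM phiE cP.
- move=> phi psi; rewrite !kdE => h; apply: rdual_val_inj => z.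
  by apply: ga_inj; rewrite -!kdP h.
- by move=> b phi; rewrite !kdE fgE; apply: kdU => z; rewrite -mulrA laZ kdP -rmorphM.
by move=> phi a; rewrite !kdE; apply: kdU => z; rewrite -mulrA -kaA kdP.
Qed.

End LastDual.

Lemma rdims_of_flag u n : (0 < n)%N -> tight_flag u n ->
  rdim_seq_period (ext_bimodule f) (1 :: nseq n.-1 2 ++ [:: 1; n])%N.
Proof.
case: n => // m _ uP; have [u0 full indep tu] := uP.
pose s := (1 :: nseq m 2 ++ [:: 1; m.+1])%N.
have size_s : size s = m.+3 by rewrite /= size_cat size_nseq addn2.
(* The realization of the [a]-th dual within one period: F over [f] for 0, then K_(a-1), and at
   [m.+2] the dual of K_m, which is F as an (F, S_m)-bimodule. *)
pose state a (A B : unitRingType) (M : bimodule A B) :=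
  if a == 0%N then realized M (fun x => exists g, x = f g) (fun=> True) (fun=> True)
  else if a == m.+2 then realized M (fun=> True) (hom u m m) (fun=> True)
  else realized M (hom u a.-1 a.-1) (hom u a a) (hom u a.-1 a).
have step a (A B : unitRingType) (M : bimodule A B) : (a < m.+3)%N ->
    GRing.field_axiom B -> state a A B M ->
    has_rdim M (nth 0%N s a) /\ state (a.+1 %% m.+3)%N B A (rdual M).
  case: a => [|a] an divB; rewrite /state /=.
    move=> MK; rewrite hom_11 // !hom_0.
    by have [] := realized_rank1 divB MK (fun x => iff_refl _).
  rewrite nth_cat size_nseq nth_nseq !eqSS.
  have [->|am] := eqVneq a m.+1.
    by rewrite modnn ltnNge leqnSn subSnn /=; exact: flag_rdual.
  rewrite modn_small; last by move: an am; clear; lia.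
  (* Here V_(m+1) = F, so K_m and S_(m+1) are both F and the dimension is 1. *)
  have [->|am'] := eqVneq a m.
    move=> MK; rewrite ltnn subnn eqxx /=.
    rewrite !(hom_full _ full) in MK.
    exact: (realized_rank1 divB MK (fun x => iff_refl _)).
  have {an am am'} am : (a < m)%N by move: an am am'; clear; lia.
  have am2 : (a.+2 == m.+2) = false by rewrite ltn_eqF.
  rewrite am am2 /= => MK.
  have [t ut] := tight_splits (tu a.+1 am).
  exact: (splits_rdual divB MK (tu a (ltnW am)) ut (indep a.+1 am)).
have seqP k : forall a (A B : unitRingType) (M : bimodule A B), (a < m.+3)%N ->
    GRing.field_axiom A -> GRing.field_axiom B -> state a A B M ->
    rdim_seq_at k M (nth 0%N s ((a + k) %% m.+3)).
  elim: k => [|k IH] a A B M am dA dB /(step _ _ _ _ am dB)[Md MK].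
    by rewrite addn0 modn_small.
  rewrite /= -addSnnS -modnDml; apply: IH => //; exact: ltn_pmod.
by move=> k; rewrite -/s size_s; apply: (seqP k 0%N) => //; exact: realized_ext.
Qed.

End Flags.

(** * The ring extension and the flag given by a tight embedding *)

Lemma flag_of_tight_embedding (G F : unitRingType)
    (divF : GRing.field_axiom F) (n : nat) (phi : {rmorphism F -> 'M[G]_n}) :
  (0 < n)%N -> tight phi ->
  exists (f : {rmorphism G -> F}) u, tight_flag f u n.
Proof.
case: n phi => // m phi _ phiT.
(* By 1-tightness F is identified with G^n through the first row of phi; scaling
   this row by g is left multiplication by f g. *)
pose rw x : 'rV[G]_m.+1 := row 0 (phi x).
have rwD x y : rw (x + y) = rw x + rw y by rewrite /rw rmorphD raddfD.
have rwM x y : rw (x * y) = rw x *m phi y by rewrite /rw rmorphM -row_mul.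
have rw0 x : rw x = 0 -> x = 0.
  move=> x0; apply/eqP; apply: contraT => /divF xu.
  have := rwM x x^-1; rewrite x0 mul0mx mulrV // /rw rmorph1 => /rowP/(_ 0).
  by rewrite !mxE eqxx => /eqP; rewrite oner_eq0.
have rw_inj x y : rw x = rw y -> x = y.
  move=> xy; apply/eqP; rewrite -subr_eq0; apply/eqP/rw0.
  by apply: (addIr (rw y)); rewrite -rwD subrK add0r.
(* This is [a.+1]-tightness in the indices of the full matrix: rows up to [a] and columns from [a]
   on can be prescribed. *)
have tightP a (a_le : (a <= m)%N) (g : 'I_m.+1 -> 'I_m.+1 -> G) :
  exists x, forall i j : 'I_m.+1,
    (i <= a)%N -> (a <= j)%N -> phi x i j = g i j.
  have a0 : (0 < a.+1)%N by [].
  have b0 : (0 < m.+1 - a)%N by rewrite subn_gt0.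
  have ab : (a.+1 + (m.+1 - a) = m.+2)%N by lia.
  have [x xP] := phiT a.+1 a_le _ a0 b0 ab (\matrix_(i, j) g (inord i) (inord (a + j))).
  exists x => i j ia aj.
  have jb : (j - a < m.+1 - a)%N by rewrite ltn_sub2r.
  have /matrixP/(_ (Ordinal (ia : (i < a.+1)%N)) (Ordinal jb)) := xP.
  rewrite !mxE /= inord_val subnKC // inord_val => <-.
  congr (phi x _ _); apply: val_inj => //=.
  move: aj (ltn_ord j); clear; lia.
have /boolp.choice[of_row of_rowK] (v : 'rV[G]_m.+1) : exists x, rw x = v.
  have [x xP] := tightP 0%N isT (fun _ j => v 0 j).
  by exists x; apply/rowP => j; rewrite mxE xP.
have delta_row g i y : (g *: delta_mx 0 i : 'rV[G]_m.+1) *m phi y = g *: row i (phi y).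
  by rewrite -scalemxAl rowE.
have [|||f fE] := @mk_rmorphism G F (fun g => of_row (g *: delta_mx 0 0)).
- by move=> g h; apply: rw_inj; rewrite rwD !of_rowK scalerDl.
- move=> g h; apply: rw_inj; rewrite rwM !of_rowK delta_row -/(rw _) of_rowK.
  by rewrite scalerA.
- by apply: rw_inj; rewrite of_rowK scale1r /rw rmorph1 rowE mulmx1.
pose u i := of_row (delta_mx 0 (inord i)).
have rwf g y : rw (f g * y) = g *: rw y.
  by rewrite rwM fE of_rowK delta_row.
have rwu i y : (i <= m)%N -> rw (u i * y) = row (inord i) (phi y).
  by rewrite rwM of_rowK -rowE.
have rwu1 i : rw (u i) = delta_mx 0 (inord i) by rewrite of_rowK.
(* The first row of [u i] is the [i]-th unit vector, so V_k is cut out by vanishing of the first row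
   from column [k] on. *)
have spanP k x : (k <= m.+1)%N -> span f u k x <->
    forall j : 'I_m.+1, (k <= j)%N -> rw x 0 j = 0.
  elim: k x => [|k IH] x km /=.
    split=> [-> j _|x0]; last by apply: rw0; apply/rowP => j; rewrite x0 // mxE.
    by rewrite /rw rmorph0 !mxE.
  have fgE g (j : 'I_m.+1) :
      rw x 0 j = rw (x - f g * u k) 0 j + g * (j == k :> nat)%:R.
    rewrite -{1}(subrK (f g * u k) x) rwD rwf rwu1 !mxE eqxx /=.
    by rewrite -val_eqE /= inordK.
  split=> [[g /(IH _ (ltnW km)) gP] j kj|x0].
    by rewrite (fgE g) (gP j (ltnW kj)) gtn_eqF // mulr0 addr0.
  exists (rw x 0 (inord k)); apply/(IH _ (ltnW km)) => j kj.
  apply: (addIr (rw x 0 (inord k) * (j == k :> nat)%:R)); rewrite -fgE add0r.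
  have [jk|jk] := eqVneq (nat_of_ord j) k.
    by rewrite mulr1 -jk inord_val.
  by rewrite mulr0 x0 // ltn_neqAle eq_sym jk.
exists f, u; split.
- apply: rw_inj; rewrite rwu1 /rw rmorph1 rowE mulmx1; congr delta_mx.
  by apply: val_inj; rewrite /= inordK.
- by move=> x; apply/spanP => // j; rewrite leqNgt ltn_ord.
- move=> i im /(spanP _ _ (ltnW im))/(_ (inord i)); rewrite inordK // leqnn rwu1 mxE !eqxx.
  by move=> /(_ isT)/eqP; rewrite oner_eq0.
(* By [rwu], the first row of [u i * x] is row [i] of [phi x], so a corner block prescribes these
   products modulo V_a. *)
move=> a am c; have [x xP] := tightP a am (fun i j => rw (c i) 0 j).
exists x => i ia; apply/spanP; first exact: ltnW.
have im : (i <= m)%N by apply: leq_trans ia _.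
move=> j aj; apply: (addIr (rw (c i) 0 j)).
have := rwD (u i * x - c i) (c i); rewrite subrK rwu // => /rowP/(_ j).
by rewrite [X in _ = X]mxE => <-; rewrite mxE xP ?inordK // add0r.
Qed.

Theorem theorem2p1 (G F : unitRingType)
    (divG : GRing.field_axiom G) (divF : GRing.field_axiom F)
    (n : nat) (n_gt1 : (1 < n)%N) :
  (exists2 f : {rmorphism G -> F}, injective f &
     rdim_seq_period (ext_bimodule f) (1 :: nseq n.-1 2 ++ [:: 1; n])%N)
  <->
  (exists2 phi : {rmorphism F -> 'M[G]_n}, injective phi & tight phi).
Proof.
have n0 : (0 < n)%N := ltnW n_gt1; split=> [[f _ dims]|[phi _ phiT]].
  have size_s : size (1 :: nseq n.-1 2 ++ [:: 1; n])%N = n.+2.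
    by rewrite /= size_cat size_nseq addn2 prednK.
  have [||u uP] := flag_of_rdims divG divF (f := f) n0.
  - have := dims n; rewrite size_s modn_small // -(prednK n0) /=.
    by rewrite nth_cat size_nseq ltnn subnn.
  - move=> k /andP[k0 kn]; have := dims k.
    rewrite size_s modn_small; last exact/leqW/leqW.
    have kn' : (k.-1 < n.-1)%N by rewrite -ltnS !prednK.
    by rewrite -(prednK k0) /= nth_cat size_nseq nth_nseq kn'.
  exact: (tight_embedding_of_flag divG n0 uP).
have [f [u uP]] := flag_of_tight_embedding divF n0 phiT.
exists f; first exact: division_rmorph_inj.
exact: (rdims_of_flag divG divF n0 uP).
Qed.
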